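(* For each of the following Lie algebras $A^{\max}$ of vector fields, the listed subalgebras form an optimal system of one-dimensional subalgebras of $A^{\max}$. Here $a$ runs over all real constants, $\sigma$ runs over $\{-1,0,1\}$, and $\rho,\nu$ are fixed real constants with $\rho\neq0$, $\rho\leqslant3/2$, $\nu\geqslant0$. Case 0. $A^{\max}=\langle\partial_x,\ t\partial_x+\partial_u\rangle$: $\ \mathfrak g=\langle\partial_x\rangle$, $\ \mathfrak g^a=\langle(t+a)\partial_x+\partial_u\rangle$. Case $1_{\rho\neq-1,4}$. $A^{\max}=\langle\partial_x,\ t\partial_x+\partial_u,\ 5t\partial_t+(\rho+1)x\partial_x+(\rho-4)u\partial_u\rangle$ with $\rho\neq-1,4$: $\ \mathfrak g=\langle\partial_x\rangle$, $\ \mathfrak g^\sigma=\langle(t+\sigma)\partial_x+\partial_u\rangle$, $\ \mathfrak g_{1.1}=\langle5t\partial_t+(\rho+1)x\partial_x+(\rho-4)u\partial_u\rangle$. Case $1_{\rho=-1}$. $A^{\max}=\langle\partial_x,\ t\partial_x+\partial_u,\ t\partial_t-u\partial_u\rangle$: $\ \mathfrak g=\langle\partial_x\rangle$, $\ \mathfrak g^\sigma=\langle(t+\sigma)\partial_x+\partial_u\rangle$, $\ \mathfrak g^a_{1.2}=\langle t\partial_t+a\partial_x-u\partial_u\rangle$. Case 2. $A^{\max}=\langle\partial_x,\ t\partial_x+\partial_u,\ 5\partial_t+x\partial_x+u\partial_u\rangle$: $\ \mathfrak g=\langle\partial_x\rangle$, $\ \mathfrak g^0=\langle t\partial_x+\partial_u\rangle$,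 $\ \mathfrak g_2=\langle5\partial_t+x\partial_x+u\partial_u\rangle$. Case 3. $A^{\max}=\langle\partial_x,\ t\partial_x+\partial_u,\ (t^2+1)\partial_t+(t+\nu)x\partial_x+((\nu-t)u+x)\partial_u\rangle$: $\ \mathfrak g=\langle\partial_x\rangle$, $\ \mathfrak g_3=\langle(t^2+1)\partial_t+(t+\nu)x\partial_x+(x+(\nu-t)u)\partial_u\rangle$. Case 4. $A^{\max}=\langle\partial_x,\ t\partial_x+\partial_u,\ \partial_t,\ 5t\partial_t+x\partial_x-4u\partial_u\rangle$: $\ \mathfrak g=\langle\partial_x\rangle$, $\ \mathfrak g_{4.1}=\langle\partial_t\rangle$, $\ \mathfrak g^\sigma_{4.2}=\langle\sigma\partial_t+t\partial_x+\partial_u\rangle$, $\ \mathfrak g_{4.3}=\langle5t\partial_t+x\partial_x-4u\partial_u\rangle$.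
   Context: The algebras are the maximal Lie invariance algebras of equations $u_t+uu_x+\beta(t)u_{xxxxx}=0$ with, respectively, general $\beta$ (Case 0), $\beta=t^\rho$ (Case 1), $\beta=e^t$ (Case 2), $\beta=(t^2+1)^{3/2}e^{5\nu\arctan t}$ (Case 3), $\beta=1$ (Case 4). An optimal system of one-dimensional subalgebras of a Lie algebra is a list of one-dimensional subalgebras such that every one-dimensional subalgebra is equivalent, under the adjoint action (the group of inner automorphisms), to exactly one member of the list. *)

(* Defs.v *)
From HB Require Import structures.
From mathcomp Require Import all_boot all_order all_algebra.
From mathcomp Require Import all_classical all_reals all_analysis.
Set Implicit Arguments.
Unset Strict Implicit.
Unset Printing Implicit Defensive.
Import Order.TTheory GRing.Theory Num.Theory.
Import numFieldNormedType.Exports.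

Local Open Scope classical_set_scope.
Local Open Scope ring_scope.

(* Vector fields on the space R^3 of the variables (t, x, u), given by their  *)
(* components. This is a notation so that the pointwise lmodType structure    *)
(* of functions applies.                                                      *)
Notation vfield R := ('rV[R]_3 -> 'rV[R]_3).

(* If F t x u = (a, b, c), mkvf F is the vector field a d_t + b d_x + c d_u.  *)
Definition mkvf (R : realType) (F : R -> R -> R -> R * R * R) : vfield R :=
  fun p => let: (a, b, c) := F (p 0 0) (p 0 1) (p 0 2%:R) in
           \row_i [:: a; b; c]`_i.

Section LieAlgebras.
Context {R : realType}.
Implicit Types (v w : vfield R) (g h k : set (vfield R)).

(* In components, [v, w]^i = v(w^i) - w(v^i), where v(f) is the derivative of *)
(* f along v.                                                                 *)
Definition bracket v w : vfield R :=
  fun p => 'D_(v p) w p - 'D_(w p) v p.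

Definition lin_span (s : seq (vfield R)) : set (vfield R) :=
  range (fun c : nat -> R => \sum_(i < size s) c i *: s`_i).

(* Antisymmetry and the Jacobi identity are not part of the definition: they  *)
(* hold automatically for brackets of smooth vector fields.                   *)
Definition lie_algebra g : Prop :=
  [/\ g 0,
      (forall (a : R) v w, g v -> g w -> g (a *: v + w)) &
      (forall v w, g v -> g w -> g (bracket v w))].

Definition one_dim_subalgebra g h : Prop :=
  [/\ h `<=` g, lie_algebra h & exists2 v, v <> 0 & h = lin_span [:: v]].

(* exp(ad v) w = \sum_n (ad v)^n w / n!, summed pointwise. The series         *)
(* converges if v and w belong to a finite-dimensional Lie algebra.           *)
Definition exp_ad v w : vfield R :=
  fun p => limn (series (fun n => (n`!%:R)^-1 *: iter n (bracket v) w p)).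

(* The group of inner automorphisms of g is generated by the exp(ad v), with  *)
(* v in g. Its elements are represented by maps on all vector fields, but     *)
(* only their restriction to g is meaningful. There, exp(ad v) and            *)
(* exp(ad (- v)) are mutually inverse, so closure under composition suffices. *)
Inductive inner_aut g : (vfield R -> vfield R) -> Prop :=
| inner_aut_id : inner_aut g id
| inner_aut_exp v : g v -> inner_aut g (exp_ad v)
| inner_aut_comp phi psi :
    inner_aut g phi -> inner_aut g psi -> inner_aut g (phi \o psi).

Definition inner_equiv g h k : Prop :=
  exists2 phi, inner_aut g phi & phi @` h = k.

Definition optimal_system g (L : set (set (vfield R))) : Prop :=
  [/\ lie_algebra g,
      (forall k, L k -> one_dim_subalgebra g k) &
      (forall h, one_dim_subalgebra g h ->
         exists! k, L k /\ inner_equiv g h k)].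

End LieAlgebras.

(* Main.v *)
Require Import Defs.
From HB Require Import structures.
From mathcomp Require Import all_boot all_order all_algebra ring lra.
From mathcomp Require Import all_classical all_reals all_analysis.
Import Order.TTheory GRing.Theory Num.Theory.
Import numFieldNormedType.Exports.
Local Open Scope classical_set_scope.
Local Open Scope ring_scope.

(* In coordinates with respect to a basis, ad v is a matrix acting on row     *)
(* vectors and exp(ad v) is its exponential, whose series always converges.   *)
(* For each algebra there is a normal form of nonzero vectors that does not   *)
(* change under exponentials and under scaling: it only depends on the        *)
(* component of the last basis field D (and on that of d_x if D commutes with *)
(* d_x), which no exponential changes, and, on the ideal where it vanishes,   *)
(* on the signs of components that are multiplied by positive numbers.        *)
(* Conversely, exponentials of ad v with v in the ideal remove the other      *)
(* components of vectors outside of the ideal, and those of ad D rescale      *)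
(* (Cases 1 and 4), shear (Case 2) or rotate (Case 3) the ideal.              *)

Set Implicit Arguments.
Unset Strict Implicit.
Unset Printing Implicit Defensive.

(** * Exponentials of matrices *)

(** A one-dimensional subalgebra is a nonzero vector up to a nonzero factor, so the orbits of the
    adjoint group on lines have to be classified. By [exp_ad_comb] this is linear algebra: in
    coordinates the inner automorphisms act as products of matrix exponentials.
    [optimal_system_normal_form] then asks for a map [nf] that is constant on lines and under
    exponentials, fixes the listed representatives, and is reached from every nonzero vector up to a
    factor.

    Exponentials are computed in three ways: [expmx_row_eigen] yields the invariants and the
    rescalings, [expmx_row_nilpotent] the moves by elements of an ideal, and [expmx_row_adjoint] the
    one-parameter groups of Cases 2 and 3. All brackets come from [bracket_pvf].

    Cases 1 to 3 extend the abelian plane of d_x and t d_x + d_u by one field D. If ad D is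
    invertible on the plane, the span of D is the only class outside ([optimal_system_nonsingular]).
    Inside, distinct real weights leave a sign, a Jordan block leaves two classes, and a rotation
    leaves one. For rho = -1 the field D commutes with d_x, which produces the parameter a. In Case
    0 the action is trivial. In Case 4 a dilation acts on a Heisenberg ideal, and its weights on the
    quotient by d_x are distinct, so a sign remains again. *)

Section MatrixExponential.
Context {R : realType} {n : nat}.
Implicit Types (A : 'M[R]_n) (d : 'rV[R]_n).

Definition exp_terms A d (j : 'I_n) : R^nat :=
  fun k => (k`!%:R)^-1 * iter k (mulmx^~ A) d 0 j.

Definition expmx_row A d : 'rV[R]_n :=
  \row_j limn (series (exp_terms A d j)).

Lemma iter_mulmxZl A d (s : R) k :
  iter k (mulmx^~ (s *: A)) d = s ^+ k *: iter k (mulmx^~ A) d.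
Proof.
elim: k => [|k IHk] /=; first by rewrite expr0 scale1r.
by rewrite IHk -scalemxAl -scalemxAr scalerA exprSr.
Qed.

Lemma iter_mulmxZr A d (a : R) k :
  iter k (mulmx^~ A) (a *: d) = a *: iter k (mulmx^~ A) d.
Proof. by elim: k => [//|k IHk] /=; rewrite IHk -scalemxAl. Qed.

(** With [M] the sum of the absolute values of all entries of [A], each multiplication by [A]
    enlarges every coordinate bound by a factor of at most [M], so the scalar series of [C * expR M]
    dominates. *)
Lemma exp_terms_cvg A d j : cvgn (series (exp_terms A d j)).
Proof.
pose M : R := \sum_i \sum_k `|A i k|; pose C : R := \sum_i `|d 0 i|.
have bound k i : `|iter k (mulmx^~ A) d 0 i| <= M ^+ k * C.
  elim: k i => [|k IHk] i /=.
    by rewrite expr0 mul1r /C (bigD1 i)//= lerDl sumr_ge0.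
  rewrite mxE (le_trans (ler_norm_sum _ _ _))// exprSr -mulrA mulrCA mulr_suml.
  apply: ler_sum => l _; rewrite normrM mulrC ler_pM//.
  by rewrite (bigD1 i)//= lerDl sumr_ge0.
apply: (@normed_cvg _ R^o).
apply: (@series_le_cvg _ _ (C *: exp_coeff M)); last 2 first.
- move=> k; rewrite /exp_terms/= normrM ger0_norm ?invr_ge0//.
  rewrite [leRHS](_ : _ = (k`!%:R)^-1 * (M ^+ k * C)) ?ler_wpM2l ?invr_ge0//.
  by rewrite [RHS]mulrC [M ^+ k * C]mulrC -mulrA.
- exact/is_cvg_seriesZ/is_cvg_series_exp_coeff.
- by move=> k /=; exact: normr_ge0.
- move=> k; rewrite /GRing.scale/= mulr_ge0 ?sumr_ge0//.
  by rewrite exp_coeff_ge0// sumr_ge0// => i _; rewrite sumr_ge0.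
Qed.

(** Used with two targets: the values of basis fields at a point, where it identifies [exp_ad], and
    the entries of a column, where it shows that the exponential commutes with [A]. *)
Lemma cvg_expmx_row_comb (V : normedModType R) (e : 'I_n -> V) A d :
  series (fun k => (k`!%:R)^-1 *:
    \sum_i iter k (mulmx^~ A) d 0 i *: e i) @ \oo -->
  \sum_i expmx_row A d 0 i *: e i.
Proof.
have -> : series (fun k => (k`!%:R)^-1 *:
    \sum_i iter k (mulmx^~ A) d 0 i *: e i) =
  fun N => \sum_i series (exp_terms A d i) N *: e i.
  apply/funext => N; rewrite /series/=.
  under eq_bigr do rewrite scaler_sumr.
  rewrite exchange_big/=; apply: eq_bigr => i _.
  by rewrite scaler_suml; apply: eq_bigr => k _; rewrite scalerA.
apply: cvg_big => [|i _]; first exact: add_continuous.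
by apply: cvgZr_tmp; rewrite mxE; exact: exp_terms_cvg.
Qed.

Lemma expmx_rowZ A d a : expmx_row A (a *: d) = a *: expmx_row A d.
Proof.
apply/rowP => j; rewrite !mxE.
rewrite -[RHS](lim_seriesZ a (@exp_terms_cvg A d j)); congr (limn (series _)).
by apply/funext => k; rewrite /exp_terms iter_mulmxZr mxE /GRing.scale/= mulrCA.
Qed.

(** On [U] the coordinate [j] is an eigenfunctional of [A], so the k-th term of the series is
    [mu ^+ k / k!] times the coordinate. For [mu = 0] this gives an invariant coordinate. *)
Lemma expmx_row_eigen A (U : set 'rV[R]_n) (j : 'I_n) (mu : R) :
  (forall d, U d -> U (d *m A)) ->
  (forall d, U d -> (d *m A) 0 j = mu * d 0 j) ->
  forall d, U d -> expmx_row A d 0 j = expR mu * d 0 j.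
Proof.
move=> UA Umu d Ud; rewrite mxE mulrC.
rewrite -[RHS](lim_seriesZ (d 0 j) (is_cvg_series_exp_coeff mu)).
congr (limn (series _)); apply/funext => k.
rewrite [RHS](_ : _ = (k`!%:R)^-1 * (d 0 j * mu ^+ k)); last first.
  by rewrite [RHS]mulrC -mulrA.
congr (_ * _).
suff [] : U (iter k (mulmx^~ A) d) /\
          iter k (mulmx^~ A) d 0 j = d 0 j * mu ^+ k by [].
elim: k => [|k [Uk IHk]] /=; first by rewrite expr0 mulr1.
by split; [exact: UA|rewrite Umu// IHk mulrCA -exprS].
Qed.

Lemma expmx_row_nilpotent A d :
  d *m A *m A = 0 -> expmx_row A d = d + d *m A.
Proof.
move=> dA0; apply/rowP => j; rewrite !mxE.
apply: (@lim_near_cst R^o) => //; near=> N.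
have N2 : (1 < N)%N by near: N; exists 2%N.
rewrite -(subnK N2) addnC /series/= /index_iota subn0 iotaD big_cat/=.
rewrite !big_cons big_nil /exp_terms/= invr1 !mul1r addr0 big1_seq ?addr0//.
  by rewrite mxE.
move=> k; rewrite mem_iota /= => /andP[k2 _].
rewrite -(subnK k2) addnC.
suff -> : iter (2 + (k - 2)) (mulmx^~ A) d = 0 by rewrite mxE mulr0.
rewrite addnC iterD/= dA0; elim: (k - 2)%N => //= m ->.
by rewrite mul0mx.
Unshelve. all: by end_near. Qed.

Lemma is_derive_expmx_row A d j (s : R) :
  is_derive s 1 (fun s => expmx_row (s *: A) d 0 j)
                (expmx_row (s *: A) (d *m A) 0 j).
Proof.
pose c d' : R^nat := exp_terms A d' j.
have termE d' s' : exp_terms (s' *: A) d' j = (fun k => c d' k * s' ^+ k).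
  apply/funext => k; rewrite /c /exp_terms iter_mulmxZl mxE.
  by rewrite mulrCA mulrC.
have cE d' : pseries_diffs (c d') = c (d' *m A).
  apply/funext => k; rewrite /pseries_diffs /c /exp_terms iterSr.
  by rewrite factS natrM invfM -!mulrA mulVKf.
have -> : (fun s => expmx_row (s *: A) d 0 j) =
          (fun s => limn (pseries (c d) s)).
  by apply/funext => s'; rewrite mxE termE.
have -> : expmx_row (s *: A) (d *m A) 0 j =
          limn (pseries (pseries_diffs (c d)) s).
  by rewrite mxE termE cE.
have cvgc d' : cvgn (pseries (c d') (`|s| + 1)).
  by have := @exp_terms_cvg ((`|s| + 1) *: A) d' j; rewrite termE.
(* Termwise differentiation at [s] requires the power series and its first two formal derivatives to
   converge beyond [|s|]. By [cE] these are the series of the rows [d], [d *m A] and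
   [d *m A *m A]. *)
apply: (@pseries_snd_diffs _ _ (`|s| + 1)); rewrite ?cE//.
by rewrite [ltRHS]ger0_norm ?ltrDl// addr_ge0.
Qed.

Lemma expmx_row_mulmx A d (s : R) :
  expmx_row (s *: A) (d *m A) = expmx_row (s *: A) d *m A.
Proof.
apply/rowP => j; rewrite !mxE.
have := @cvg_expmx_row_comb R^o (fun i => A i j) (s *: A) d.
rewrite (_ : (fun k => _) = exp_terms (s *: A) (d *m A) j); last first.
  apply/funext => k; rewrite /exp_terms /GRing.scale/=; congr (_ * _).
  transitivity ((iter k (mulmx^~ (s *: A)) d *m A) 0 j); first by rewrite mxE.
  congr (fun_of_matrix _ 0 j); elim: k => //= k <-.
  by rewrite -!mulmxA -!scalemxAl -!scalemxAr.
by move/cvg_lim => ->.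
Qed.

(* Explicit solutions l of the adjoint equation l' = - A l evaluate the       *)
(* exponential without any diagonalization.                                   *)
Lemma expmx_row_adjoint A d (l : R -> 'cV[R]_n) :
  (forall s j, is_derive s (1 : R) (fun s => l s j 0) (- (A *m l s) j 0)) ->
  forall s, (expmx_row (s *: A) d *m l s) 0 0 = (d *m l 0) 0 0.
Proof.
move=> dl s; have {2}-> : d = expmx_row (0 *: A) d.
  by rewrite expmx_row_nilpotent scale0r mulmx0 ?addr0// mul0mx.
apply: (@is_derive_0_is_cst _ (fun s => (expmx_row (s *: A) d *m l s) 0 0)).
move=> {}s; pose F i s := expmx_row (s *: A) d 0 i.
have -> : (fun s => (expmx_row (s *: A) d *m l s) 0 0) =
          \sum_i (F i * (fun s => l s i 0)).
  by apply/funext => s'; rewrite mxE fct_sumE.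
have dF i : is_derive s 1 (F i) ((expmx_row (s *: A) d *m A) 0 i).
  by rewrite -expmx_row_mulmx; exact: is_derive_expmx_row.
apply: is_derive_eq; rewrite big_split/=.
transitivity (- (expmx_row (s *: A) d *m (A *m l s)) 0 0 +
              (expmx_row (s *: A) d *m A *m l s) 0 0).
  rewrite !mxE -sumrN; congr (_ + _); apply: eq_bigr => i _.
    by rewrite /GRing.scale/= mulrN.
  by rewrite /GRing.scale/= mulrC.
by rewrite mulmxA addNr.
Qed.

End MatrixExponential.

(** * Lie algebras in coordinates *)

Section Coordinates.
Context {R : realType} {n : nat}.
Implicit Types (c d r : 'rV[R]_n) (v w : vfield R).

Lemma lin_span1 v : lin_span [:: v] = [set a *: v | a in setT].
Proof.
apply/seteqP; split.
  by move=> _ [c _ <-]; exists (c 0%N) => //; rewrite big_ord1.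
by move=> _ [a _ <-]; exists (fun=> a) => //; rewrite big_ord1.
Qed.

Lemma bracketC v w : bracket v w = - bracket w v.
Proof. by apply/funext => p; rewrite /bracket/= opprB. Qed.

Lemma bracketvv v : bracket v v = 0.
Proof. by apply/funext => p; rewrite /bracket subrr. Qed.

Definition comb (e : 'I_n -> vfield R) d : vfield R := \sum_i d 0 i *: e i.

Lemma combE e d p : comb e d p = \sum_i d 0 i *: e i p.
Proof. by rewrite /comb fct_sumE. Qed.

Lemma comb0 e : comb e 0 = 0.
Proof. by rewrite /comb big1// => i _; rewrite mxE scale0r. Qed.

Lemma combZ e a d : comb e (a *: d) = a *: comb e d.
Proof.
by rewrite /comb scaler_sumr; apply: eq_bigr => i _; rewrite mxE scalerA.
Qed.

Lemma combD e c d : comb e (c + d) = comb e c + comb e d.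
Proof.
by rewrite /comb -big_split; apply: eq_bigr => i _; rewrite mxE scalerDl.
Qed.

Lemma lin_span_comb (s : seq (vfield R)) : size s = n ->
  lin_span s = range (comb (fun i => s`_i)).
Proof.
move=> sn; apply/seteqP; split.
  move=> _ [c _ <-]; exists (\row_i c i) => //; rewrite sn.
  by apply: eq_bigr => i _; rewrite mxE.
move=> _ [d _ <-]; exists (fun k => oapp (d 0) 0 (insub k)) => //; rewrite sn.
by apply: eq_bigr => i _; rewrite valK.
Qed.

(** Coordinate form of the images of [d] under [inner_aut], with exponentials appended one at a
    time. *)
Inductive adjoint_orbit (A : 'rV[R]_n -> 'M[R]_n) d : 'rV[R]_n -> Prop :=
| adjoint_orbit_refl : adjoint_orbit A d d
| adjoint_orbit_exp c d' :
    adjoint_orbit A d d' -> adjoint_orbit A d (expmx_row (A c) d').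

Variables (e : 'I_n -> vfield R) (A : 'rV[R]_n -> 'M[R]_n).
Hypothesis e_free : forall d, comb e d = 0 -> d = 0.
Hypothesis bracket_comb :
  forall c d, bracket (comb e c) (comb e d) = comb e (d *m A c).

Local Notation g := (range (comb e)).

Lemma comb_inj : injective (comb e).
Proof.
move=> c d cd; apply/eqP; rewrite -subr_eq0; apply/eqP/e_free.
by rewrite combD -scaleN1r combZ scaleN1r cd subrr.
Qed.

Lemma lie_algebra_comb : lie_algebra g.
Proof.
split; first by exists 0; rewrite ?comb0.
  by move=> a _ _ [c _ <-] [d _ <-]; exists (a *: c + d); rewrite ?combD ?combZ.
by move=> _ _ [c _ <-] [d _ <-]; rewrite bracket_comb; exists (d *m A c).
Qed.

Lemma one_dim_subalgebra_comb r : r != 0 ->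
  one_dim_subalgebra g (lin_span [:: comb e r]).
Proof.
move=> r0; rewrite lin_span1.
(* The formula for the bracket is visibly linear in the second argument only, so antisymmetry moves
   the scalar [a] there, leaving the bracket of a field with itself. *)
have rr a : r *m A (a *: r) = 0.
  apply: e_free; rewrite -bracket_comb combZ bracketC -combZ.
  rewrite bracket_comb -scalemxAl combZ -bracket_comb bracketvv.
  by rewrite scaler0 oppr0.
split.
- by move=> _ [a _ <-]; exists (a *: r); rewrite ?combZ.
- split; first by exists 0; rewrite ?scale0r.
    move=> a _ _ [b _ <-] [c _ <-]; exists (a * b + c) => //.
    by rewrite scalerDl scalerA.
  move=> _ _ [a _ <-] [b _ <-]; exists 0 => //; rewrite scale0r.
  by rewrite -!combZ bracket_comb -scalemxAl rr scaler0 comb0.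
- exists (comb e r); last by rewrite lin_span1.
  by move=> /e_free/eqP; rewrite (negbTE r0).
Qed.

Lemma exp_ad_comb c d :
  exp_ad (comb e c) (comb e d) = comb e (expmx_row (A c) d).
Proof.
apply/funext => p; rewrite /exp_ad combE; apply/cvg_lim => //.
rewrite (_ : (fun k => _) = fun k => (k`!%:R)^-1 *:
    \sum_i iter k (mulmx^~ (A c)) d 0 i *: e i p).
  exact: cvg_expmx_row_comb.
apply/funext => k; rewrite -combE; congr (_ *: _ p).
by elim: k => //= k ->; rewrite bracket_comb.
Qed.

Lemma inner_aut_orbit d d' : adjoint_orbit A d d' ->
  exists2 phi, inner_aut g phi &
    forall a, phi (comb e (a *: d)) = comb e (a *: d').
Proof.
elim=> [|c {}d' _ [phi phig phiE]].
  by exists id; first exact: inner_aut_id.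
exists (exp_ad (comb e c) \o phi).
  by apply: inner_aut_comp phig; apply: inner_aut_exp; exists c.
by move=> a /=; rewrite phiE exp_ad_comb expmx_rowZ.
Qed.

(* Uniqueness uses nf as an invariant, so that the inner automorphisms need   *)
(* not be inverted.                                                          *)
Lemma optimal_system_normal_form (nf : 'rV[R]_n -> 'rV[R]_n)
    (L : set 'rV[R]_n) :
  (forall c d, nf (expmx_row (A c) d) = nf d) ->
  (forall a d, a != 0 -> nf (a *: d) = nf d) ->
  (forall r, L r -> nf r = r /\ r != 0) ->
  (forall d, d != 0 -> L (nf d) /\
     exists2 a, a != 0 & adjoint_orbit A d (a *: nf d)) ->
  optimal_system g [set lin_span [:: comb e r] | r in L].
Proof.
move=> nf_exp nf_scale nfL nf_orbit; split; first exact: lie_algebra_comb.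
  by move=> _ [r /nfL[_ r0] <-]; exact: one_dim_subalgebra_comb.
move=> h [hg _ [v v0 hE]]; rewrite {}hE in hg *.
have [d _ dv] : g v by apply: hg; rewrite lin_span1; exists 1; rewrite ?scale1r.
have d0 : d != 0 by apply/eqP => d0; apply: v0; rewrite -dv d0 comb0.
rewrite -{}dv => {v v0 hg}.
have [Ld [a a0 dd]] := nf_orbit _ d0.
exists (lin_span [:: comb e (nf d)]); split.
  split; first by exists (nf d).
  have [phi phig phiE] := inner_aut_orbit dd; exists phi => //.
  rewrite !lin_span1; apply/seteqP; split.
    move=> _ [_ [b _ <-] <-]; exists (b * a) => //.
    by rewrite -!combZ phiE scalerA.
  move=> _ [b _ <-]; exists ((b / a) *: comb e d).
    by exists (b / a).
  by rewrite -!combZ phiE scalerA divfK.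
move=> _ [[r Lr <-] [phi phig phih]]; congr (lin_span [:: comb e _]).
(* Any inner automorphism acts on coordinates, preserves [nf] and fixes zero. As [r] is nonzero, the
   last fact forces [b] to be nonzero below, so that [nf_scale] applies. *)
have phinf c : exists2 c', phi (comb e c) = comb e c' &
    nf c' = nf c /\ (c = 0 -> c' = 0).
  elim: phig c => {phi phih} [c|_ [b _ <-] c|phi psi _ IHphi _ IHpsi c].
  - by exists c.
  - exists (expmx_row (A b) c); first by rewrite exp_ad_comb.
    split=> // ->; rewrite -[X in expmx_row _ X](scale0r 0) expmx_rowZ.
    by rewrite scale0r.
  - have [c1 /= -> [<- c1_0]] := IHpsi c; have [c2 -> [<- c2_0]] := IHphi c1.
    by exists c2 => //; split=> // /c1_0/c2_0.
have [nfr r0] := nfL _ Lr.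
have : lin_span [:: comb e r] (comb e r).
  by rewrite lin_span1; exists 1; rewrite ?scale1r.
rewrite -phih lin_span1 => -[_ [b _ <-]]; rewrite -combZ.
have [c' -> [nfc' c'0]] := phinf (b *: d) => /comb_inj rE.
rewrite -nfr -rE nfc' nf_scale//; apply: contraNneq r0 => b0.
by rewrite -rE c'0// b0 scale0r.
Qed.

End Coordinates.

(** * A Lie algebra that contains all the symmetry algebras *)

Section ProjectableFields.
Context {R : realType}.
Implicit Types (p h : 'rV[R]_3).

(* Six-parameter algebra, closed under brackets, of which every A^max is a    *)
(* subalgebra: sl_2 acting projectively on t, the translations along d_x and  *)
(* t d_x + d_u, and the dilation x d_x + u d_u.                               *)
Definition pvf (k0 k1 k2 m c1 c2 : R) : vfield R :=
  mkvf (fun t x u => (k0 + k1 * t + k2 * t ^+ 2,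
                      c1 + c2 * t + (m + k1 + k2 * t) * x,
                      c2 + k2 * x + (m - k2 * t) * u)).

(** The components of [pvf] are polynomials of degree at most two along every line, so a directional
    derivative is read off as the linear coefficient. *)
Lemma derive_quadratic (w : vfield R) p h (a b : 'rV[R]_3) :
  (forall s, w (s *: h + p) = w p + s *: a + s ^+ 2 *: b) -> 'D_h w p = a.
Proof.
move=> wE; apply/cvg_lim => //.
apply: (@cvg_trans _ ((a + s *: b) @[s --> 0^'])).
  apply: near_eq_cvg; near=> s => /=.
  have s0 : s != 0 by near: s; exact: nbhs_dnbhs_neq.
  rewrite wE -(addrA (w p)) addrAC subrr add0r scalerDr !scalerA mulVf//.
  rewrite scale1r; by rewrite expr2 mulKf.
apply: cvg_trans; first exact/cvg_app/cvg_within.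
rewrite -[X in _ --> X]addr0 -[X in _ + X](scale0r b).
by apply: cvgD; [exact: cvg_cst|apply: cvgZr_tmp; exact: cvg_id].
Unshelve. all: by end_near. Qed.

Lemma derive_pvf k0 k1 k2 m c1 c2 p h :
  'D_h (pvf k0 k1 k2 m c1 c2) p = \row_i
    [:: (k1 + 2 * k2 * p 0 0) * h 0 0;
        (c2 + k2 * p 0 1) * h 0 0 + (m + k1 + k2 * p 0 0) * h 0 1;
        - k2 * p 0 2%:R * h 0 0 + k2 * h 0 1 + (m - k2 * p 0 0) * h 0 2%:R]`_i.
Proof.
apply: (@derive_quadratic _ _ _ _ (\row_i
  [:: k2 * h 0 0 ^+ 2; k2 * h 0 0 * h 0 1; - k2 * h 0 0 * h 0 2%:R]`_i)) => s.
by apply/rowP => -[[|[|[|//]]] ?]; rewrite /pvf /mkvf !mxE /=; ring.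
Qed.

Lemma bracket_pvf k0 k1 k2 m c1 c2 k0' k1' k2' m' c1' c2' :
  bracket (pvf k0 k1 k2 m c1 c2) (pvf k0' k1' k2' m' c1' c2') =
  pvf (k0 * k1' - k0' * k1) (2 * (k0 * k2' - k0' * k2)) (k1 * k2' - k1' * k2)
      (k0' * k2 - k0 * k2')
      (k0 * c2' + c1 * (m' + k1') - (k0' * c2 + c1' * (m + k1)))
      (c1 * k2' + c2 * m' - (c1' * k2 + c2' * m)).
Proof.
apply/funext => p; rewrite /bracket !derive_pvf.
by apply/rowP => -[[|[|[|//]]] ?]; rewrite /pvf /mkvf !mxE /=; ring.
Qed.

Lemma pvfD k0 k1 k2 m c1 c2 k0' k1' k2' m' c1' c2' :
  pvf k0 k1 k2 m c1 c2 + pvf k0' k1' k2' m' c1' c2' =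
  pvf (k0 + k0') (k1 + k1') (k2 + k2') (m + m') (c1 + c1') (c2 + c2').
Proof.
apply/funext => p; rewrite fctE.
by apply/rowP => -[[|[|[|//]]] ?]; rewrite /pvf /mkvf !mxE /=; ring.
Qed.

Lemma pvfZ a k0 k1 k2 m c1 c2 :
  a *: pvf k0 k1 k2 m c1 c2 =
  pvf (a * k0) (a * k1) (a * k2) (a * m) (a * c1) (a * c2).
Proof.
apply/funext => p; rewrite fctE.
by apply/rowP => -[[|[|[|//]]] ?]; rewrite /pvf /mkvf !mxE /=; ring.
Qed.

Lemma pvf_eq0 k0 k1 k2 m c1 c2 : pvf k0 k1 k2 m c1 c2 = 0 ->
  [/\ k0 = 0, k1 = 0, k2 = 0 & [/\ m = 0, c1 = 0 & c2 = 0]].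
Proof.
move=> w0.
have E t x u i : pvf k0 k1 k2 m c1 c2 (\row_j [:: t; x; u]`_j) 0 i = 0.
  by rewrite w0 mxE.
(* The origin yields [k0], [c1] and [c2], the points t = 1 and t = -1 yield [k1] and [k2], and u = 1
   yields [m]. *)
have := (E 0 0 0 0, E 0 0 0 1, E 0 0 0 2%:R,
         (E 1 0 0 0, E (-1) 0 0 0, E 0 0 1 2%:R)).
rewrite /pvf /mkvf !mxE /= => -[[[e1 e2] e3] [[e4 e5] e6]].
by split; [lra..|split; lra].
Qed.

End ProjectableFields.

(** * Extensions of the ideal spanned by d_x and t d_x + d_u *)

Section SignNormalization.
Context {R : realType}.
Implicit Types a b x y mu nu : R.

Lemma sgr_div_pos x y a b : 0 < x -> 0 < y ->
  Num.sg ((x * a) / (y * b)) = Num.sg (a / b).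
Proof. by move=> x0 y0; rewrite -mulf_div sgrM gtr0_sg ?divr_gt0// mul1r. Qed.

Lemma sgr_div_scale x a b : x != 0 ->
  Num.sg ((x * a) / (x * b)) = Num.sg (a / b).
Proof. by move=> x0; rewrite -mulf_div mulfV// mul1r. Qed.

Lemma sgr_in_signs x : [set -1; 0; 1] (Num.sg x).
Proof. by case: sgrP => _; [left; right|right|left; left]. Qed.

Lemma sgr_signs x : [set -1; 0; 1] x -> Num.sg x = x.
Proof. by move=> [[->|->]|->]; rewrite ?sgrN ?sgr1 ?sgr0. Qed.

(** Two coordinates that grow at different rates can be brought to equal absolute value, by solving
    for [s] with a logarithm; only the sign of their ratio survives. *)
Lemma expR_balance a b mu nu : mu != nu -> b != 0 ->
  exists s, expR (s * mu) * a = expR (s * nu) * b * Num.sg (a / b).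
Proof.
move=> munu b0; have [->|a0] := eqVneq a 0.
  by exists 0; rewrite mulr0 !mul0r sgr0 mulr0.
have mn0 : mu - nu != 0 by rewrite subr_eq0.
have ab0 : 0 < `|b / a| by rewrite normr_gt0 mulf_neq0// invr_eq0.
exists (ln `|b / a| / (mu - nu)); set s := _ / _.
have -> : s * mu = s * nu + ln `|b / a|.
  by apply/eqP; rewrite addrC -subr_eq -mulrBr divfK.
rewrite expRD lnK ?posrE// -!mulrA; congr (_ * _).
rewrite normrM normfV sgrM sgrV {2}[a]numEsg (normrEsg b).
by field; rewrite normr_eq0.
Qed.

End SignNormalization.

Section RowVectors3.
Context {R : realType}.

Definition row3 (a b c : R) : 'rV[R]_3 := \row_i [:: a; b; c]`_i.

Lemma row3P d : exists a b c, d = row3 a b c.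
Proof.
exists (d 0 0), (d 0 1), (d 0 2%:R); apply/rowP => i; rewrite mxE.
by case: i => -[|[|[|//]]] ? /=; congr (d _ _); exact/val_inj.
Qed.

Lemma row3E a b c :
  (row3 a b c 0 0 = a) * (row3 a b c 0 1 = b) * (row3 a b c 0 2%:R = c).
Proof. by rewrite !mxE. Qed.

Lemma row3Z x a b c : x *: row3 a b c = row3 (x * a) (x * b) (x * c).
Proof. by apply/rowP => -[[|[|[|//]]] ?]; rewrite !mxE. Qed.

Lemma row3D a b c x y z :
  row3 a b c + row3 x y z = row3 (a + x) (b + y) (c + z).
Proof. by apply/rowP => -[[|[|[|//]]] ?]; rewrite !mxE. Qed.

Lemma row3_eq0 a b c : (row3 a b c == 0) = [&& a == 0, b == 0 & c == 0].
Proof.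
apply/eqP/and3P => [d0|[/eqP-> /eqP-> /eqP->]].
  by have := row3E a b c; rewrite d0 !mxE => -[[<- <-] <-]; rewrite eqxx.
by apply/rowP => -[[|[|[|//]]] ?]; rewrite !mxE.
Qed.

End RowVectors3.

(** * The adjoint action of an abelian plane extended by one element D *)

Section PlanarExtension.
Context {R : realType}.
Variables m11 m12 m21 m22 : R.

(* The algebra <e1, e2, D> with [e1, e2] = 0, [D, e1] = m11 e1 + m12 e2 and   *)
(* [D, e2] = m21 e1 + m22 e2; row vectors are multiplied on the right by      *)
(* [ad3 c].                                                                   *)
Definition ad3 (c : 'rV[R]_3) : 'M[R]_3 :=
  \matrix_(i, j) (nth [::]
    [:: [:: c 0 2%:R * m11; c 0 2%:R * m12; 0];
        [:: c 0 2%:R * m21; c 0 2%:R * m22; 0];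
        [:: - (c 0 0 * m11 + c 0 1 * m21); - (c 0 0 * m12 + c 0 1 * m22); 0]]
    i)`_j.

Lemma mul_ad3 x y z a b c : row3 a b c *m ad3 (row3 x y z) =
  row3 (a * z * m11 + b * z * m21 - c * (x * m11 + y * m21))
       (a * z * m12 + b * z * m22 - c * (x * m12 + y * m22)) 0.
Proof.
apply/rowP => -[[|[|[|//]]] ?];
  by rewrite !mxE !big_ord_recl big_ord0 !mxE /=; ring.
Qed.

Lemma ad3Z s c : ad3 (s *: c) = s *: ad3 c.
Proof.
apply/matrixP => -[[|[|[|//]]] ?] -[[|[|[|//]]] ?];
  by rewrite !mxE /=; ring.
Qed.

Lemma exp_ad3_2 c d : expmx_row (ad3 c) d 0 2%:R = d 0 2%:R.
Proof.
have [x [y [z ->]]] := row3P c.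
rewrite (@expmx_row_eigen _ _ _ setT _ 0) ?expR0 ?mul1r// => d' _.
have [a' [b' [c' ->]]] := row3P d'.
by rewrite mul_ad3 !row3E mul0r.
Qed.

Lemma exp_ad3_ideal c a b : exists a' b',
  expmx_row (ad3 c) (row3 a b 0) = row3 a' b' 0.
Proof.
have [a' [b' [c' E]]] := row3P (expmx_row (ad3 c) (row3 a b 0)).
exists a', b'; rewrite E; have := exp_ad3_2 c (row3 a b 0).
by rewrite E !row3E => ->.
Qed.

(* As ad D is invertible on the ideal, every element outside of the ideal is  *)
(* moved to its D-component by a single exponential from the ideal.          *)
Lemma ad3_straighten a b c : m11 * m22 - m12 * m21 != 0 -> c != 0 ->
  adjoint_orbit ad3 (row3 a b c) (c *: row3 0 0 1).
Proof.
set D := _ - _ => D0 c0.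
(* Cramer's rule: [v] lies in the ideal and its bracket with [c] D cancels the components [a] and
   [b]. The ideal is abelian, so the exponential series stops after the linear term. *)
pose v :=
  row3 ((a * m22 - b * m21) / (D * c)) ((b * m11 - a * m12) / (D * c)) 0.
suff <- : expmx_row (ad3 v) (row3 a b c) = c *: row3 0 0 1.
  exact/adjoint_orbit_exp/adjoint_orbit_refl.
rewrite row3Z !mulr0 mulr1 expmx_row_nilpotent !mul_ad3 ?row3D.
  by congr row3; rewrite ?/D; field; rewrite ?c0 ?andbT ?D0.
by apply/eqP; rewrite row3_eq0; apply/and3P; split=> //; apply/eqP; ring.
Qed.

End PlanarExtension.

(** * Diagonal action on the plane: normal forms up to a sign *)

Section DiagonalExtension.
Context {R : realType}.
Variables m1 m2 : R.
Let A := @ad3 R m1 0 0 m2.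

Lemma exp_ad3_diag x y z a b : expmx_row (A (row3 x y z)) (row3 a b 0) =
  row3 (expR (z * m1) * a) (expR (z * m2) * b) 0.
Proof.
pose U := [set d : 'rV[R]_3 | d 0 2%:R = 0].
have UA d : U d -> U (d *m A (row3 x y z)).
  have [a' [b' [c' ->]]] := row3P d.
  by rewrite /U/= mul_ad3 !row3E.
have e1 d : U d -> (d *m A (row3 x y z)) 0 0 = z * m1 * d 0 0.
  have [a' [b' [c' ->]]] := row3P d; rewrite /U/= mul_ad3 !row3E => ->.
  by ring.
have e2 d : U d -> (d *m A (row3 x y z)) 0 1 = z * m2 * d 0 1.
  have [a' [b' [c' ->]]] := row3P d; rewrite /U/= mul_ad3 !row3E => ->.
  by ring.
have Ud : U (row3 a b 0) by rewrite /U/= !row3E.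
have := (expmx_row_eigen UA e1 Ud, expmx_row_eigen UA e2 Ud).
have [a' [b' ->]] := exp_ad3_ideal m1 0 0 m2 (row3 x y z) a b.
by rewrite !row3E => -[-> ->].
Qed.

(** Exponentials multiply [a / b] by a positive number and scaling preserves it, so its sign is the
    invariant of a line outside the span of e1. *)
Definition nf_ideal (a b : R) : 'rV[R]_3 :=
  if b != 0 then row3 (Num.sg (a / b)) 1 0 else row3 1 0 0.

Lemma nf_ideal_mem a b :
  ([set row3 1 0 0] `|` (fun s => row3 s 1 0) @` [set -1; 0; 1]) (nf_ideal a b).
Proof.
rewrite /nf_ideal; case: ifP => _; last by left.
by right; exists (Num.sg (a / b)) => //; exact: sgr_in_signs.
Qed.

Lemma nf_ideal_exp c a b a' b' :
  expmx_row (A c) (row3 a b 0) = row3 a' b' 0 ->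
  nf_ideal a' b' = nf_ideal a b.
Proof.
have [x [y [z ->]]] := row3P c; rewrite exp_ad3_diag => E.
have := row3E a' b' 0; rewrite -E !row3E => -[[<- <-] _].
by rewrite /nf_ideal mulf_eq0 expR_eq0/= sgr_div_pos ?expR_gt0.
Qed.

Lemma nf_idealZ x a b : x != 0 -> nf_ideal (x * a) (x * b) = nf_ideal a b.
Proof. by move=> x0; rewrite /nf_ideal mulf_eq0 (negbTE x0) sgr_div_scale. Qed.

Lemma nf_ideal_orbit a b : m1 != m2 -> row3 a b 0 != 0 ->
  exists2 x, x != 0 & adjoint_orbit A (row3 a b 0) (x *: nf_ideal a b).
Proof.
move=> m12; rewrite row3_eq0 eqxx andbT /nf_ideal.
have [->|b0 _] := eqVneq b 0.
  rewrite andbT => a0; exists a => //; rewrite row3Z !(mulr0, mulr1).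
  exact: adjoint_orbit_refl.
have [s sE] := expR_balance a m12 b0.
exists (expR (s * m2) * b); first by rewrite mulf_neq0 ?expR_eq0.
rewrite row3Z mulr1 mulr0 -sE -(exp_ad3_diag 0 0).
exact/adjoint_orbit_exp/adjoint_orbit_refl.
Qed.

End DiagonalExtension.

(** * Planar extensions realized by vector fields *)

Section PlanarFields.
Context {R : realType}.
Variables k0 k1 k2 m : R.

Definition basis3 : 'I_3 -> vfield R :=
  fun i => [:: pvf 0 0 0 0 1 0; pvf 0 0 0 0 0 1; pvf k0 k1 k2 m 0 0]`_i.

Lemma comb_basis3 a b c : comb basis3 (row3 a b c) =
  pvf (c * k0) (c * k1) (c * k2) (c * m) a b.
Proof.
rewrite /comb !big_ord_recl big_ord0 !mxE /= !pvfZ addr0 !pvfD.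
by congr pvf; ring.
Qed.

Lemma bracket_basis3 c d : bracket (comb basis3 c) (comb basis3 d) =
  comb basis3 (d *m ad3 (- (m + k1)) (- k2) k0 (- m) c).
Proof.
have [x [y [z ->]]] := row3P c; have [a' [b' [c' ->]]] := row3P d.
by rewrite mul_ad3 !comb_basis3 bracket_pvf; congr pvf; ring.
Qed.

Lemma basis3_free : pvf k0 k1 k2 m 0 0 != 0 ->
  forall d, comb basis3 d = 0 -> d = 0.
Proof.
move=> D0 d; have [a [b [c ->]]] := row3P d; rewrite comb_basis3 => E.
have [_ _ _ [_ a0 b0]] := pvf_eq0 E; apply/eqP; rewrite row3_eq0 a0 b0 !eqxx/=.
move: E; rewrite a0 b0 -[X in pvf _ _ _ _ X](mulr0 c).
rewrite -[X in pvf _ _ _ _ _ X](mulr0 c) -pvfZ => /eqP.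
by rewrite scaler_eq0 (negbTE D0) orbF.
Qed.

Lemma optimal_system_basis3 (nf : 'rV[R]_3 -> 'rV[R]_3) (L : set 'rV[R]_3) :
  let A := ad3 (- (m + k1)) (- k2) k0 (- m) in
  pvf k0 k1 k2 m 0 0 != 0 ->
  (forall c d, nf (expmx_row (A c) d) = nf d) ->
  (forall a d, a != 0 -> nf (a *: d) = nf d) ->
  (forall r, L r -> nf r = r /\ r != 0) ->
  (forall d, d != 0 -> L (nf d) /\
     exists2 a, a != 0 & adjoint_orbit A d (a *: nf d)) ->
  optimal_system
    (lin_span [:: pvf 0 0 0 0 1 0; pvf 0 0 0 0 0 1; pvf k0 k1 k2 m 0 0])
    [set lin_span [:: comb basis3 r] | r in L].
Proof.
move=> A D0 *; rewrite (@lin_span_comb _ 3)//.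
apply: (@optimal_system_normal_form _ _ _ A _ _ nf) => //.
- exact: basis3_free.
- exact: bracket_basis3.
Qed.

(** The hypothesis on [(m + k1) * m + k0 * k2] says that the determinant of ad D on the ideal is
    nonzero. Then [ad3_straighten] settles all lines outside the ideal, and [nf] only has to
    classify the lines inside. *)
Lemma optimal_system_nonsingular (nf : R -> R -> 'rV[R]_3)
    (L : set 'rV[R]_3) :
  let A := ad3 (- (m + k1)) (- k2) k0 (- m) in
  (m + k1) * m + k0 * k2 != 0 ->
  (forall c a b a' b', expmx_row (A c) (row3 a b 0) = row3 a' b' 0 ->
     nf a' b' = nf a b) ->
  (forall x a b, x != 0 -> nf (x * a) (x * b) = nf a b) ->
  (forall r, L r -> exists a b, [/\ r = row3 a b 0, nf a b = r & r != 0]) ->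
  (forall a b, row3 a b 0 != 0 -> L (nf a b) /\
     exists2 x, x != 0 & adjoint_orbit A (row3 a b 0) (x *: nf a b)) ->
  optimal_system
    (lin_span [:: pvf 0 0 0 0 1 0; pvf 0 0 0 0 0 1; pvf k0 k1 k2 m 0 0])
    [set lin_span [:: comb basis3 r] | r in L `|` [set row3 0 0 1]].
Proof.
move=> A det nf_exp nfZ nfL nf_orbit.
apply: (optimal_system_basis3 (nf := fun d => if d 0 2%:R != 0
  then row3 0 0 1 else nf (d 0 0) (d 0 1))).
- apply: contraNneq det => /pvf_eq0[k0E _ _ [mE _ _]].
  by rewrite k0E mE mulr0 mul0r addr0.
- move=> c d /=; rewrite exp_ad3_2; case: ifPn => // /negPn/eqP.
  have [a [b [c' ->]]] := row3P d; rewrite !row3E => ->.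
  have [a' [b' E]] := exp_ad3_ideal (- (m + k1)) (- k2) k0 (- m) c a b.
  by rewrite E !row3E; exact: nf_exp E.
- move=> x d x0; rewrite !mxE mulf_eq0 (negbTE x0)/=; case: ifP => // _.
  exact: nfZ.
- move=> _ [/nfL[a [b [-> nfE r0]]]|->]; first by rewrite !row3E eqxx.
  by rewrite !row3E row3_eq0 oner_eq0 !andbF.
- move=> d; have [a [b [c ->]]] := row3P d; rewrite !row3E.
  have [->|c0 _] /= := eqVneq c 0.
    by move=> /nf_orbit[Lnf orb]; split=> //; left.
  split; first by right.
  exists c => //; apply: ad3_straighten => //.
  by rewrite mulrNN mulNr opprK mulrC [k2 * _]mulrC mulrC.
Qed.

End PlanarFields.

(** * Optimal systems for Cases 0 to 3 *)

Section PlanarOptimalSystems.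
Context {R : realType}.

Lemma mkvf_dx : mkvf (fun t x u : R => (0, 1, 0)) = pvf 0 0 0 0 1 0.
Proof. by congr mkvf; do 3 apply/funext => ?; congr (_, _, _); ring. Qed.

Lemma mkvf_galilei_shift (a : R) :
  mkvf (fun t x u : R => (0, t + a, 1)) = pvf 0 0 0 0 a 1.
Proof. by congr mkvf; do 3 apply/funext => ?; congr (_, _, _); ring. Qed.

Lemma mkvf_galilei : mkvf (fun t x u : R => (0, t, 1)) = pvf 0 0 0 0 0 1.
Proof. by congr mkvf; do 3 apply/funext => ?; congr (_, _, _); ring. Qed.

Lemma optimal_system_case1 (rho : R) : rho != -1 -> rho != 4 ->
   optimal_system
    (lin_span [:: mkvf (fun t x u : R => (0, 1, 0));
                  mkvf (fun t x u : R => (0, t, 1));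
                  mkvf (fun t x u : R =>
                          (5 * t, (rho + 1) * x, (rho - 4) * u))])
    ([set lin_span [:: mkvf (fun t x u : R => (0, 1, 0))]]
     `|` [set lin_span [:: mkvf (fun t x u : R => (0, t + sigma, 1))]
         | sigma in [set -1; 0; 1]]
     `|` [set lin_span [:: mkvf (fun t x u : R =>
                          (5 * t, (rho + 1) * x, (rho - 4) * u))]]).
Proof.
move=> rho1 rho4; rewrite mkvf_dx mkvf_galilei.
have DE : mkvf (fun t x u : R => (5 * t, (rho + 1) * x, (rho - 4) * u)) =
          pvf 0 5 0 (rho - 4) 0 0.
  by congr mkvf; do 3 apply/funext => ?; congr (_, _, _); ring.
rewrite DE; pose L : set 'rV[R]_3 :=
  [set row3 1 0 0] `|` (fun s => row3 s 1 0) @` [set -1; 0; 1].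
rewrite [X in optimal_system _ X](_ : _ =
    [set lin_span [:: comb (basis3 0 5 0 (rho - 4)) r]
    | r in L `|` [set row3 0 0 1]]); last first.
  (* The set of signs is abstracted, since [image_setU] would otherwise split it as a union. *)
  rewrite /L; move: [set -1; 0; 1] => S.
  rewrite !image_setU !image_set1 image_comp !comb_basis3 !mul0r !mul1r.
  congr (_ `|` _ `|` _); apply: eq_imagel => s _ /=.
  by rewrite comb_basis3 !mul0r mkvf_galilei_shift.

have p0 : rho - 4 + 5 != 0 by rewrite (_ : _ + 5 = rho - -1) ?subr_eq0//; ring.
have q0 : rho - 4 != 0 by rewrite subr_eq0.
apply: (optimal_system_nonsingular (nf := nf_ideal)); rewrite ?oppr0.
- by rewrite mul0r addr0 mulf_neq0.
- by move=> c a b a' b'; exact: nf_ideal_exp.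
- exact: nf_idealZ.
- move=> _ [->|[s /sgr_signs sE <-]].
    exists 1, 0; rewrite /nf_ideal eqxx row3_eq0 oner_eq0/=.
    by split.
  exists s, 1; rewrite /nf_ideal oner_eq0 row3_eq0 oner_eq0 andbF divr1 sE.
  by split.
- move=> a b ab0; split; first exact: nf_ideal_mem.
  apply: nf_ideal_orbit => //.
  (* The two weights of ad D differ by 5. *)
  by apply/eqP; lra.
Qed.

(** Here ad D kills d_x and is singular, so [optimal_system_nonsingular] does not apply: the ratio
    of the d_x- and D-components is an invariant outside the ideal, whence the family in [a]. *)
Lemma optimal_system_case1_singular :
   optimal_system
    (lin_span [:: mkvf (fun t x u : R => (0, 1, 0));
                  mkvf (fun t x u : R => (0, t, 1));
                  mkvf (fun t x u : R => (t, 0, - u))])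
    ([set lin_span [:: mkvf (fun t x u : R => (0, 1, 0))]]
     `|` [set lin_span [:: mkvf (fun t x u : R => (0, t + sigma, 1))]
         | sigma in [set -1; 0; 1]]
     `|` [set lin_span [:: mkvf (fun t x u : R => (t, a, - u))] | a in setT]).
Proof.
have DE a : mkvf (fun t x u : R => (t, a, - u)) = pvf 0 1 0 (-1) a 0.
  by congr mkvf; do 3 apply/funext => ?; congr (_, _, _); ring.
rewrite mkvf_dx mkvf_galilei DE; pose L : set 'rV[R]_3 :=
  [set row3 1 0 0] `|` (fun s => row3 s 1 0) @` [set -1; 0; 1]
  `|` (fun a => row3 a 0 1) @` setT.
rewrite [X in optimal_system _ X](_ : _ =
    [set lin_span [:: comb (basis3 0 1 0 (-1)) r] | r in L]); last first.
  rewrite /L; move: [set -1; 0; 1] => S.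
  rewrite !image_setU !image_set1 !image_comp !comb_basis3 !mul0r.
  congr (_ `|` _ `|` _); apply: eq_imagel => s _ /=.
    by rewrite comb_basis3 !mul0r mkvf_galilei_shift.
  by rewrite comb_basis3 !mul1r DE.
apply: (optimal_system_basis3 (nf := fun d => if d 0 2%:R != 0
  then row3 (d 0 0 / d 0 2%:R) 0 1 else nf_ideal (d 0 0) (d 0 1)));
  rewrite ?oppr0 ?opprK ?addNr ?oppr0.
- by apply/eqP => /pvf_eq0[_ /eqP]; rewrite oner_eq0.
- move=> c d; rewrite exp_ad3_2; case: ifPn => [_|/negPn/eqP].
    (* Every [ad3 c] takes values in the line of e2, so the first coordinate is fixed. *)
    rewrite (@expmx_row_eigen _ _ _ setT _ 0) ?expR0 ?mul1r// => d' _.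
    have [x [y [z ->]]] := row3P c; have [a' [b' [c' ->]]] := row3P d'.
    by rewrite mul_ad3 !row3E; ring.
  have [a [b [c' ->]]] := row3P d; rewrite !row3E => ->.
  have [a' [b' E]] := exp_ad3_ideal 0 0 0 1 c a b.
  by rewrite E !row3E; exact: nf_ideal_exp E.
- move=> x d x0; rewrite !mxE mulf_eq0 (negbTE x0)/=; case: ifP => _.
    by rewrite -mulf_div mulfV// mul1r.
  exact: nf_idealZ.
- move=> _ [[->|[s /sgr_signs sE <-]]|[a _ <-]];
    rewrite /nf_ideal !row3E row3_eq0 ?eqxx oner_eq0 ?andbF ?divr1 ?sE//.
- move=> d; have [a [b [c ->]]] := row3P d; rewrite !row3E.
  have [->|c0 _] /= := eqVneq c 0.
    move=> ab0; split; first by left; exact: nf_ideal_mem.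
    by apply: nf_ideal_orbit => //; rewrite eq_sym oner_eq0.
  split; first by right; exists (a / c).
  exists c => //; rewrite row3Z mulr0 mulr1 mulrCA mulfV// mulr1.
  suff <- :
      expmx_row (ad3 0 0 0 1 (row3 0 (b / c) 0)) (row3 a b c) = row3 a 0 c.
    exact/adjoint_orbit_exp/adjoint_orbit_refl.
  rewrite expmx_row_nilpotent !mul_ad3 ?row3D.
    by congr row3; field.
  by apply/eqP; rewrite row3_eq0; apply/and3P; split=> //; apply/eqP; ring.
Qed.

(** On the ideal ad D is a Jordan block: the exponential of [s] D sends (a, b) to [expR (- s)] times
    (a + 5 s b, b). Hence only the vanishing of b is invariant. *)
Lemma optimal_system_case2 :
   optimal_system
    (lin_span [:: mkvf (fun t x u : R => (0, 1, 0));
                  mkvf (fun t x u : R => (0, t, 1));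
                  mkvf (fun t x u : R => (5, x, u))])
    ([set lin_span [:: mkvf (fun t x u : R => (0, 1, 0))]]
     `|` [set lin_span [:: mkvf (fun t x u : R => (0, t, 1))]]
     `|` [set lin_span [:: mkvf (fun t x u : R => (5, x, u))]]).
Proof.
have DE : mkvf (fun t x u : R => (5, x, u)) = pvf 5 0 0 1 0 0.
  by congr mkvf; do 3 apply/funext => ?; congr (_, _, _); ring.
rewrite mkvf_dx mkvf_galilei DE.
pose L : set 'rV[R]_3 := [set row3 1 0 0; row3 0 1 0].
rewrite [X in optimal_system _ X](_ : _ = [set lin_span
    [:: comb (basis3 5 0 0 1) r] | r in L `|` [set row3 0 0 1]]); last first.
  by rewrite /L !image_setU !image_set1 !comb_basis3 !mul0r !mul1r.
apply: (optimal_system_nonsingular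
  (nf := fun a b => if b != 0 then row3 0 1 0 else row3 1 0 0));
  rewrite ?addr0 ?oppr0.
- by rewrite mulr0 addr0 mulr1 oner_eq0.
- move=> c a b a' b' E; pose U := [set d : 'rV[R]_3 | d 0 2%:R = 0].
  have := @expmx_row_eigen _ _ (ad3 (-1) 0 5 (-1) c) U 1 (- c 0 2%:R) _ _
    (row3 a b 0).
  rewrite E !row3E => -> //; rewrite /U/= ?row3E//.
  + by rewrite mulf_eq0 expR_eq0.
  + move=> d; have [x [y [z ->]]] := row3P c.
    by have [p [q [r ->]]] := row3P d; rewrite mul_ad3 !row3E.
  + move=> d; have [x [y [z ->]]] := row3P c.
    have [p [q [r ->]]] := row3P d; rewrite mul_ad3 !row3E => ->; ring.
- by move=> x a b x0; rewrite mulf_eq0 (negbTE x0).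
- move=> _ [->|->]; [exists 1, 0|exists 0, 1];
    by rewrite row3_eq0 ?eqxx ?oner_eq0 /= ?andbF; split.
- move=> a b; rewrite row3_eq0 eqxx andbT.
  have [->|b0 _] /= := eqVneq b 0.
    rewrite andbT => a0; split; first by left.
    by exists a => //; rewrite row3Z !mulr0 mulr1; exact: adjoint_orbit_refl.
  split; first by right.
  (* The time at which the shear cancels the first coordinate: a + 5 s b = 0. *)
  pose s := - a / (5 * b); exists (expR (- s) * b).
    by rewrite mulf_neq0 ?expR_eq0.
  set A := ad3 (-1) 0 5 (-1).
  suff <- : expmx_row (s *: A (row3 0 0 1)) (row3 a b 0) =
      (expR (- s) * b) *: row3 0 1 0.
    rewrite /A -ad3Z; exact/adjoint_orbit_exp/adjoint_orbit_refl.
  rewrite -ad3Z.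
  have [a' [b' E]] := exp_ad3_ideal (-1) 0 5 (-1) (s *: row3 0 0 1) a b.
  rewrite E row3Z mulr0 mulr1.
  (* [l1] and [l2] solve the adjoint equation and start at the first two unit columns, so they give
     two linear equations for [a'] and [b']. *)
  pose l1 s : 'cV[R]_3 := \col_i [:: expR s; - 5 * s * expR s; 0]`_i.
  pose l2 s : 'cV[R]_3 := \col_i [:: 0; expR s; 0]`_i.
  have := @expmx_row_adjoint _ _ (A (row3 0 0 1)) (row3 a b 0) l1 _ s.
  have := @expmx_row_adjoint _ _ (A (row3 0 0 1)) (row3 a b 0) l2 _ s.
  rewrite -ad3Z E !mxE !big_ord_recl !big_ord0 !mxE /= expR0.
  rewrite !(mulr0, mul0r, mulr1, addr0, add0r) => H2 H1.
  have {}H2 : b' * expR s = b.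
    apply: H2 => t -[[|[|[|//]]] ?]; under eq_fun do rewrite mxE /=;
      apply: is_derive_eq; rewrite !mxE !big_ord_recl big_ord0 !mxE /= ?row3E;
      ring.
  have {}H1 : a' * expR s + b' * (-5 * s * expR s) = a.
    apply: H1 => t -[[|[|[|//]]] ?]; under eq_fun do rewrite mxE /=;
      apply: is_derive_eq; rewrite !mxE !big_ord_recl big_ord0 !mxE /= ?row3E;
      rewrite /GRing.scale/=; ring.
  have a'0 : a' = 0.
    apply: (mulIf (lt0r_neq0 (expR_gt0 s))); rewrite mul0r.
    move/eqP: H1; rewrite mulrCA H2 /s eq_sym -subr_eq => /eqP <-; field.
    by rewrite b0.
  by rewrite a'0 -H2 expRN mulrC -mulrA mulfV ?mulr1// gt_eqF ?expR_gt0.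
Qed.

(** On the ideal ad D has eigenvalues - nu + i and - nu - i: its exponentials rotate and rescale the
    plane, so every line in it can be turned to that of d_x. *)
Lemma optimal_system_case3 (nu : R) :
   optimal_system
    (lin_span [:: mkvf (fun t x u : R => (0, 1, 0));
                  mkvf (fun t x u : R => (0, t, 1));
                  mkvf (fun t x u : R =>
                          (t ^+ 2 + 1, (t + nu) * x, (nu - t) * u + x))])
    ([set lin_span [:: mkvf (fun t x u : R => (0, 1, 0))]]
     `|` [set lin_span [:: mkvf (fun t x u : R =>
                          (t ^+ 2 + 1, (t + nu) * x, x + (nu - t) * u))]]).
Proof.
have DE : mkvf (fun t x u : R => (t ^+ 2 + 1, (t + nu) * x, (nu - t) * u + x)) =
          pvf 1 0 1 nu 0 0.
  by congr mkvf; do 3 apply/funext => ?; congr (_, _, _); ring.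
have DE' : mkvf (fun t x u : R => (t ^+ 2 + 1, (t + nu) * x, x + (nu - t) * u)) =
          pvf 1 0 1 nu 0 0.
  by congr mkvf; do 3 apply/funext => ?; congr (_, _, _); ring.
rewrite mkvf_dx mkvf_galilei DE DE'; pose L : set 'rV[R]_3 := [set row3 1 0 0].
rewrite [X in optimal_system _ X](_ : _ = [set lin_span
    [:: comb (basis3 1 0 1 nu) r] | r in L `|` [set row3 0 0 1]]); last first.
  by rewrite /L !image_setU !image_set1 !comb_basis3 !mul0r !mul1r.
apply: (optimal_system_nonsingular (nf := fun _ _ => row3 1 0 0)) => //;
  rewrite ?addr0.
- by rewrite mul1r gt_eqF// ltr_wpDl// -expr2 sqr_ge0.
- by move=> _ ->; exists 1, 0; rewrite row3_eq0 oner_eq0; split.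
move=> a b ab0; split=> //.
(* The angle of (a, b), for which the rotated second coordinate vanishes. *)
have [s sE] : exists s, b * cos s - a * sin s = 0.
  have [a0|a0] := eqVneq a 0.
    by exists (pi / 2); rewrite a0 mul0r cos_pihalf mulr0 subr0.
  exists (atan (b / a)); apply/eqP; rewrite subr_eq0; apply/eqP.
  have c0 : cos (atan (b / a)) != 0.
    by rewrite gt_eqF// cos_gt0_pihalf// atan_gtNpi2 atan_ltpi2.
  have := atanK (b / a); rewrite /tan => /(canRL (divfK c0)) ->.
  by rewrite mulrCA mulrA divfK.
set A := ad3 (- nu) (-1) 1 (- nu).
have [a' [b' E]] := exp_ad3_ideal (- nu) (-1) 1 (- nu) (s *: row3 0 0 1) a b.
pose l1 s : 'cV[R]_3 :=
  \col_i [:: expR (nu * s) * cos s; - (expR (nu * s) * sin s); 0]`_i.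
pose l2 s : 'cV[R]_3 :=
  \col_i [:: expR (nu * s) * sin s; expR (nu * s) * cos s; 0]`_i.
have := @expmx_row_adjoint _ _ (A (row3 0 0 1)) (row3 a b 0) l1 _ s.
have := @expmx_row_adjoint _ _ (A (row3 0 0 1)) (row3 a b 0) l2 _ s.
rewrite -ad3Z E !mxE !big_ord_recl !big_ord0 !mxE /= !mulr0 expR0 sin0 cos0.
rewrite !(oppr0, mulr0, mul0r, mulr1, addr0, add0r) => H2 H1.
have {}H2 : a' * (expR (nu * s) * sin s) + b' * (expR (nu * s) * cos s) = b.
  apply: H2 => t -[[|[|[|//]]] ?]; under eq_fun do rewrite mxE /=;
    apply: is_derive_eq; rewrite !mxE !big_ord_recl big_ord0 !mxE /= ?row3E;
    rewrite /GRing.scale/=; ring.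
have {}H1 : a' * (expR (nu * s) * cos s) - b' * (expR (nu * s) * sin s) = a.
  rewrite -mulrN.
  apply: H1 => t -[[|[|[|//]]] ?]; under eq_fun do rewrite mxE /=;
    apply: is_derive_eq; rewrite !mxE !big_ord_recl big_ord0 !mxE /= ?row3E;
    rewrite /GRing.scale/=; ring.
have b'0 : b' = 0.
  apply: (mulIf (lt0r_neq0 (expR_gt0 (nu * s)))); rewrite mul0r -sE -H1 -H2.
  rewrite -[LHS]mulr1 -(cos2Dsin2 s); ring.
exists a'.
  apply: contraNneq ab0 => a'0; rewrite row3_eq0 -H1 -H2 a'0 b'0 !mul0r.
  by rewrite addr0 subr0 eqxx.
rewrite row3Z !mulr0 mulr1; rewrite b'0 in E; rewrite -E.
exact/adjoint_orbit_exp/adjoint_orbit_refl.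
Qed.

Definition row2 (a b : R) : 'rV[R]_2 := \row_i [:: a; b]`_i.

Lemma optimal_system_case0 :
  optimal_system
    (lin_span [:: mkvf (fun t x u : R => (0, 1, 0));
                  mkvf (fun t x u : R => (0, t, 1))])
    ([set lin_span [:: mkvf (fun t x u : R => (0, 1, 0))]]
     `|` [set lin_span [:: mkvf (fun t x u : R => (0, t + a, 1))] | a in setT]).
Proof.
have row2P d : exists a b, d = row2 a b.
  exists (d 0 0), (d 0 1); apply/rowP => i; rewrite mxE.
  by case: i => -[|[|//]] ? /=; congr (d _ _); exact/val_inj.
pose e (i : 'I_2) : vfield R := [:: pvf 0 0 0 0 1 0; pvf 0 0 0 0 0 1]`_i.
have combE a b : comb e (row2 a b) = pvf 0 0 0 0 a b.
  rewrite /comb !big_ord_recl big_ord0 !mxE /= !pvfZ addr0 !pvfD.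
  by congr pvf; ring.
have row2_eq0 a b : (row2 a b == 0) = (a == 0) && (b == 0).
  apply/eqP/andP => [/rowP d0|[/eqP-> /eqP->]].
    by have := (d0 0, d0 1); rewrite !mxE /= => -[-> ->].
  by apply/rowP => -[[|[|//]] ?]; rewrite !mxE.
have row2Z x a b : x *: row2 a b = row2 (x * a) (x * b).
  by apply/rowP => -[[|[|//]] ?]; rewrite !mxE.
rewrite mkvf_dx mkvf_galilei (@lin_span_comb _ 2)//.
pose L : set 'rV[R]_2 := [set row2 1 0] `|` (fun a => row2 a 1) @` setT.
rewrite [X in optimal_system _ X](_ : _ =
    [set lin_span [:: comb e r] | r in L]); last first.
  rewrite /L !image_setU !image_set1 !image_comp combE.
  congr (_ `|` _); apply: eq_imagel => s _ /=.
  by rewrite combE mkvf_galilei_shift.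
(* The algebra is abelian: all exponentials are trivial and each line is its own class, normalized
   by its last nonzero coordinate. *)
apply: (@optimal_system_normal_form _ _ e (fun=> 0) _ _ (fun d =>
  if d 0 1 != 0 then row2 (d 0 0 / d 0 1) 1 else row2 1 0)).
- move=> d; have [a [b ->]] := row2P d; rewrite combE => E.
  by have [_ _ _ [_ -> ->]] := pvf_eq0 E; apply/eqP; rewrite row2_eq0 eqxx.
- move=> c d; have [x [y ->]] := row2P c; have [a [b ->]] := row2P d.
  rewrite mulmx0 comb0 !combE bracket_pvf; apply/funext => p.
  by apply/rowP => -[[|[|[|//]]] ?]; rewrite /pvf /mkvf !mxE /=; ring.
- by move=> c d; rewrite expmx_row_nilpotent ?mulmx0// addr0.
- move=> x d x0; rewrite !mxE mulf_eq0 (negbTE x0)/=.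
  by rewrite -mulf_div mulfV// mul1r.
- by move=> _ [->|[a _ <-]];
    rewrite !mxE/= row2_eq0 ?eqxx oner_eq0 ?andbF ?divr1.
- move=> d; have [a [b ->]] := row2P d; rewrite row2_eq0 !mxE/=.
  have [->|b0 _] /= := eqVneq b 0.
    rewrite andbT => a0; split; first by left.
    by exists a => //; rewrite row2Z mulr0 mulr1; exact: adjoint_orbit_refl.
  split; first by right; exists (a / b).
  exists b => //; rewrite row2Z mulr1 mulrCA mulfV// mulr1.
  exact: adjoint_orbit_refl.
Qed.

End PlanarOptimalSystems.

(** * Case 4 *)

Section HeisenbergExtension.
Context {R : realType}.
Implicit Types (d : 'rV[R]_4) (a b k c x y z s : R).

Definition row4 a b k c : 'rV[R]_4 := \row_i [:: a; b; k; c]`_i.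

Lemma row4P d : exists a b k c, d = row4 a b k c.
Proof.
exists (d 0 0), (d 0 1), (d 0 2%:R), (d 0 3%:R); apply/rowP => i; rewrite mxE.
by case: i => -[|[|[|[|//]]]] ? /=; congr (d _ _); exact/val_inj.
Qed.

Lemma row4E a b k c :
  (row4 a b k c 0 0 = a) * (row4 a b k c 0 1 = b) *
  (row4 a b k c 0 2%:R = k) * (row4 a b k c 0 3%:R = c).
Proof. by rewrite !mxE. Qed.

Lemma row4Z x a b k c :
  x *: row4 a b k c = row4 (x * a) (x * b) (x * k) (x * c).
Proof. by apply/rowP => -[[|[|[|[|//]]]] ?]; rewrite !mxE. Qed.

Lemma row4D a b k c x y z s :
  row4 a b k c + row4 x y z s = row4 (a + x) (b + y) (k + z) (c + s).
Proof. by apply/rowP => -[[|[|[|[|//]]]] ?]; rewrite !mxE. Qed.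

Lemma row4_eq0 a b k c :
  (row4 a b k c == 0) = [&& a == 0, b == 0, k == 0 & c == 0].
Proof.
apply/eqP/and4P => [d0|[/eqP-> /eqP-> /eqP-> /eqP->]].
  by have := row4E a b k c; rewrite d0 !mxE => -[[[<- <-] <-] <-].
by apply/rowP => -[[|[|[|[|//]]]] ?]; rewrite !mxE.
Qed.

(* Coordinates with respect to e1 = d_x, e2 = t d_x + d_u, e3 = d_t and       *)
(* D = 5t d_t + x d_x - 4u d_u, where [e2, e3] = - e1, [e1, D] = e1,          *)
(* [e2, D] = - 4 e2, [e3, D] = 5 e3.                                          *)
Definition ad4 (c : 'rV[R]_4) : 'M[R]_4 :=
  \matrix_(i, j) (nth [::]
    [:: [:: - c 0 3%:R; 0; 0; 0];
        [:: c 0 2%:R; 4 * c 0 3%:R; 0; 0];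
        [:: - c 0 1; 0; - 5 * c 0 3%:R; 0];
        [:: c 0 0; - 4 * c 0 1; 5 * c 0 2%:R; 0]] i)`_j.

Lemma mul_ad4 a b k c x y z s : row4 a b k c *m ad4 (row4 x y z s) =
  row4 (- (s * a) + z * b - y * k + x * c) (4 * s * b - 4 * y * c)
       (- 5 * s * k + 5 * z * c) 0.
Proof.
apply/rowP => -[[|[|[|[|//]]]] ?];
  by rewrite !mxE !big_ord_recl big_ord0 !mxE /=; ring.
Qed.

Lemma exp_ad4_e1 a b k c x :
  expmx_row (ad4 (row4 x 0 0 0)) (row4 a b k c) = row4 (a + x * c) b k c.
Proof.
rewrite expmx_row_nilpotent !mul_ad4 ?row4D; first by congr row4; ring.
by apply/eqP; rewrite row4_eq0; apply/and4P; split=> //; apply/eqP; ring.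
Qed.

Lemma exp_ad4_e2 a b k c y :
  expmx_row (ad4 (row4 0 y 0 0)) (row4 a b k c) =
  row4 (a - y * k) (b - 4 * y * c) k c.
Proof.
rewrite expmx_row_nilpotent !mul_ad4 ?row4D; first by congr row4; ring.
by apply/eqP; rewrite row4_eq0; apply/and4P; split=> //; apply/eqP; ring.
Qed.

Lemma exp_ad4_e3 a b k c z :
  expmx_row (ad4 (row4 0 0 z 0)) (row4 a b k c) =
  row4 (a + z * b) b (k + 5 * z * c) c.
Proof.
rewrite expmx_row_nilpotent !mul_ad4 ?row4D; first by congr row4; ring.
by apply/eqP; rewrite row4_eq0; apply/and4P; split=> //; apply/eqP; ring.
Qed.

Lemma exp_ad4_3 v d : expmx_row (ad4 v) d 0 3%:R = d 0 3%:R.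
Proof.
have [x [y [z [s ->]]]] := row4P v.
rewrite (@expmx_row_eigen _ _ _ setT _ 0) ?expR0 ?mul1r// => d' _.
have [a' [b' [k' [c' ->]]]] := row4P d'.
by rewrite mul_ad4 !row4E mul0r.
Qed.

(** Brackets within the Heisenberg ideal lie in the line of e1, so on the coordinates of e2 and e3
    only the D-component of [v] acts, with weights 4 and -5. *)
Lemma exp_ad4_ideal v d : d 0 3%:R = 0 ->
  (expmx_row (ad4 v) d 0 1 = expR (4 * v 0 3%:R) * d 0 1) *
  (expmx_row (ad4 v) d 0 2%:R = expR (- 5 * v 0 3%:R) * d 0 2%:R).
Proof.
have [x [y [z [s ->]]]] := row4P v => dU.
pose U := [set d : 'rV[R]_4 | d 0 3%:R = 0].
by split; apply: (@expmx_row_eigen _ _ _ U) => // d';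
  have [a' [b' [k' [c' ->]]]] := row4P d';
  rewrite /U/= mul_ad4 !row4E => // ->; ring.
Qed.

Lemma exp_ad4_dilation b k s : expmx_row (ad4 (row4 0 0 0 s)) (row4 0 b k 0) =
  row4 0 (expR (s * 4) * b) (expR (s * - 5) * k) 0.
Proof.
have [a' [b' [k' [c' E]]]] :=
  row4P (expmx_row (ad4 (row4 0 0 0 s)) (row4 0 b k 0)).
have := exp_ad4_ideal (row4 0 0 0 s) (row4E 0 b k 0).2.
have := exp_ad4_3 (row4 0 0 0 s) (row4 0 b k 0).
have : expmx_row (ad4 (row4 0 0 0 s)) (row4 0 b k 0) 0 0 =
       expR (- s) * row4 0 b k 0 0 0.
  apply: (@expmx_row_eigen _ _ _ setT) => // d _.
  have [p [q [r [t ->]]]] := row4P d.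
  by rewrite mul_ad4 !row4E; ring.
rewrite E !row4E mulr0 => -> -> [-> ->]; congr row4; congr (expR _ * _); ring.
Qed.

(** The e1-coordinate counts only when all others vanish, since otherwise some exponential removes
    it. *)
Definition nf4 d : 'rV[R]_4 :=
  if d 0 3%:R != 0 then row4 0 0 0 1
  else if d 0 1 != 0 then row4 0 1 (Num.sg (d 0 2%:R / d 0 1)) 0
  else if d 0 2%:R != 0 then row4 0 0 1 0 else row4 1 0 0 0.

Lemma nf4_exp v d : nf4 (expmx_row (ad4 v) d) = nf4 d.
Proof.
rewrite /nf4 exp_ad4_3; case: ifPn => // /negPn/eqP d3.
rewrite !(exp_ad4_ideal v d3) !mulf_eq0 !expR_eq0/=.
by rewrite sgr_div_pos ?expR_gt0.
Qed.

Lemma nf4Z x d : x != 0 -> nf4 (x *: d) = nf4 d.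
Proof.
by move=> x0; rewrite /nf4 !mxE !mulf_eq0 (negbTE x0)/= sgr_div_scale.
Qed.

Lemma nf4_orbit d : d != 0 ->
  exists2 a, a != 0 & adjoint_orbit ad4 d (a *: nf4 d).
Proof.
have [a [b [k [c ->]]]] := row4P d; rewrite row4_eq0 /nf4 !row4E.
have orbit1 v d' : expmx_row (ad4 v) (row4 a b k c) = d' ->
    adjoint_orbit ad4 (row4 a b k c) d'.
  by move=> <-; exact/adjoint_orbit_exp/adjoint_orbit_refl.
have [c0|c0 _] /= := eqVneq c 0; last first.
  exists c => //; rewrite row4Z !mulr0 mulr1.
  (* With [c] nonzero, [y] removes b; then [z] removes k without touching the first coordinate,
     because b is already zero; finally [x] removes what is left there. *)
  pose y := b / (4 * c); pose z := - k / (5 * c); pose x := (y * k - a) / c.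
  have -> : row4 0 0 0 c = expmx_row (ad4 (row4 x 0 0 0))
      (expmx_row (ad4 (row4 0 0 z 0)) (row4 (a - y * k) 0 k c)).
    by rewrite exp_ad4_e3 exp_ad4_e1; congr row4; rewrite /x /z; field.
  do 2 apply: adjoint_orbit_exp; apply: (orbit1 (row4 0 y 0 0)).
  by rewrite exp_ad4_e2; congr row4; rewrite /y; field.
rewrite {}c0 in orbit1 *; have [b0|b0 _] /= := eqVneq b 0; last first.
  have n54 : (- 5 : R) != 4 by apply/eqP; lra.
  (* An exponential of e3 first removes [a], using that b is nonzero; the dilation by [s] then makes
     the e3-coordinate equal to the e2-coordinate times the sign. *)
  have [s sE] := expR_balance k n54 b0.
  exists (expR (s * 4) * b); first by rewrite mulf_neq0 ?expR_eq0.
  rewrite row4Z mulr1 !mulr0 -sE -exp_ad4_dilation.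
  apply: adjoint_orbit_exp; apply: (orbit1 (row4 0 0 (- a / b) 0)).
  by rewrite exp_ad4_e3; congr row4; field.
rewrite {}b0 in orbit1 *; have [k0|k0 _] /= := eqVneq k 0; last first.
  exists k => //; rewrite row4Z mulr1 !mulr0.
  apply: (orbit1 (row4 0 (a / k) 0 0)).
  by rewrite exp_ad4_e2; congr row4; field.
rewrite ?andbT => a0; exists a => //; rewrite row4Z mulr1 !mulr0 k0.
exact: adjoint_orbit_refl.
Qed.

Definition basis4 : 'I_4 -> vfield R := fun i =>
  [:: pvf 0 0 0 0 1 0; pvf 0 0 0 0 0 1; pvf 1 0 0 0 0 0; pvf 0 5 0 (-4) 0 0]`_i.

Lemma comb_basis4 a b k c :
  comb basis4 (row4 a b k c) = pvf k (5 * c) 0 (- 4 * c) a b.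
Proof.
rewrite /comb !big_ord_recl big_ord0 !mxE /= !pvfZ addr0 !pvfD.
by congr pvf; ring.
Qed.

Lemma bracket_basis4 v d :
  bracket (comb basis4 v) (comb basis4 d) = comb basis4 (d *m ad4 v).
Proof.
have [x [y [z [s ->]]]] := row4P v; have [a' [b' [k' [c' ->]]]] := row4P d.
by rewrite mul_ad4 !comb_basis4 bracket_pvf; congr pvf; ring.
Qed.

Lemma basis4_free d : comb basis4 d = 0 -> d = 0.
Proof.
have [a [b [k [c ->]]]] := row4P d; rewrite comb_basis4 => E.
have [k0 c0 _ [_ a0 b0]] := pvf_eq0 E.
apply/eqP; rewrite row4_eq0 a0 b0 k0 eqxx/=.
by apply/eqP; lra.
Qed.

Lemma optimal_system_case4 :
  optimal_system
    (lin_span [:: mkvf (fun t x u : R => (0, 1, 0));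
                  mkvf (fun t x u : R => (0, t, 1));
                  mkvf (fun t x u : R => (1, 0, 0));
                  mkvf (fun t x u : R => (5 * t, x, - 4 * u))])
    ([set lin_span [:: mkvf (fun t x u : R => (0, 1, 0))]]
     `|` [set lin_span [:: mkvf (fun t x u : R => (1, 0, 0))]]
     `|` [set lin_span [:: mkvf (fun t x u : R => (sigma, t, 1))]
         | sigma in [set -1; 0; 1]]
     `|` [set lin_span [:: mkvf (fun t x u : R => (5 * t, x, - 4 * u))]]).
Proof.
have e3E : mkvf (fun t x u : R => (1, 0, 0)) = pvf 1 0 0 0 0 0.
  by congr mkvf; do 3 apply/funext => ?; congr (_, _, _); ring.
have e4E : mkvf (fun t x u : R => (5 * t, x, - 4 * u)) = pvf 0 5 0 (-4) 0 0.
  by congr mkvf; do 3 apply/funext => ?; congr (_, _, _); ring.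
have e23E s : mkvf (fun t x u : R => (s, t, 1)) = pvf s 0 0 0 0 1.
  by congr mkvf; do 3 apply/funext => ?; congr (_, _, _); ring.
rewrite mkvf_dx mkvf_galilei e3E e4E (@lin_span_comb _ 4)//.
pose L : set 'rV[R]_4 := [set row4 1 0 0 0] `|` [set row4 0 0 1 0]
  `|` (fun s => row4 0 1 s 0) @` [set -1; 0; 1] `|` [set row4 0 0 0 1].
rewrite [X in optimal_system _ X](_ : _ =
    [set lin_span [:: comb basis4 r] | r in L]); last first.
  rewrite /L; move: [set -1; 0; 1] => S.
  rewrite !image_setU !image_set1 image_comp !comb_basis4 !mulr0 !mulr1.
  congr (_ `|` _ `|` _ `|` _); apply: eq_imagel => s _ /=.
  by rewrite comb_basis4 !mulr0 e23E.
apply: (@optimal_system_normal_form _ _ basis4 ad4 _ _ nf4).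
- exact: basis4_free.
- exact: bracket_basis4.
- exact: nf4_exp.
- by move=> x d; exact: nf4Z.
- by move=> _ [[[->|->]|[s /sgr_signs sE <-]]|->];
    rewrite /nf4 !row4E row4_eq0 ?eqxx ?oner_eq0 ?andbF ?divr1 ?sE.
- move=> d d0; split; last exact: nf4_orbit.
  rewrite /nf4; case: ifP => _; first by right.
  case: ifP => _; last by case: ifP => _; left; left; [right|left].
  left; right; exists (Num.sg (d 0 2%:R / d 0 1)) => //.
  exact: sgr_in_signs.
Qed.

End HeisenbergExtension.

Unset Implicit Arguments.

Theorem mainTheorem5 (R : realType) :
  (* Case 0 *)
  optimal_system
    (lin_span [:: mkvf (fun t x u : R => (0, 1, 0));
                  mkvf (fun t x u : R => (0, t, 1))])
    ([set lin_span [:: mkvf (fun t x u : R => (0, 1, 0))]]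
     `|` [set lin_span [:: mkvf (fun t x u : R => (0, t + a, 1))] | a in setT])
  /\
  (* Case 1, rho different from -1 and 4 *)
  (forall rho : R, rho != 0 -> rho <= 3 / 2 -> rho != -1 -> rho != 4 ->
   optimal_system
    (lin_span [:: mkvf (fun t x u : R => (0, 1, 0));
                  mkvf (fun t x u : R => (0, t, 1));
                  mkvf (fun t x u : R =>
                          (5 * t, (rho + 1) * x, (rho - 4) * u))])
    ([set lin_span [:: mkvf (fun t x u : R => (0, 1, 0))]]
     `|` [set lin_span [:: mkvf (fun t x u : R => (0, t + sigma, 1))]
         | sigma in [set -1; 0; 1]]
     `|` [set lin_span [:: mkvf (fun t x u : R =>
                          (5 * t, (rho + 1) * x, (rho - 4) * u))]]))
  /\
  (* Case 1, rho = -1 *)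
  optimal_system
    (lin_span [:: mkvf (fun t x u : R => (0, 1, 0));
                  mkvf (fun t x u : R => (0, t, 1));
                  mkvf (fun t x u : R => (t, 0, - u))])
    ([set lin_span [:: mkvf (fun t x u : R => (0, 1, 0))]]
     `|` [set lin_span [:: mkvf (fun t x u : R => (0, t + sigma, 1))]
         | sigma in [set -1; 0; 1]]
     `|` [set lin_span [:: mkvf (fun t x u : R => (t, a, - u))] | a in setT])
  /\
  (* Case 2 *)
  optimal_system
    (lin_span [:: mkvf (fun t x u : R => (0, 1, 0));
                  mkvf (fun t x u : R => (0, t, 1));
                  mkvf (fun t x u : R => (5, x, u))])
    ([set lin_span [:: mkvf (fun t x u : R => (0, 1, 0))]]
     `|` [set lin_span [:: mkvf (fun t x u : R => (0, t, 1))]]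
     `|` [set lin_span [:: mkvf (fun t x u : R => (5, x, u))]])
  /\
  (* Case 3 *)
  (forall nu : R, 0 <= nu ->
   optimal_system
    (lin_span [:: mkvf (fun t x u : R => (0, 1, 0));
                  mkvf (fun t x u : R => (0, t, 1));
                  mkvf (fun t x u : R =>
                          (t ^+ 2 + 1, (t + nu) * x, (nu - t) * u + x))])
    ([set lin_span [:: mkvf (fun t x u : R => (0, 1, 0))]]
     `|` [set lin_span [:: mkvf (fun t x u : R =>
                          (t ^+ 2 + 1, (t + nu) * x, x + (nu - t) * u))]]))
  /\
  (* Case 4 *)
  optimal_system
    (lin_span [:: mkvf (fun t x u : R => (0, 1, 0));
                  mkvf (fun t x u : R => (0, t, 1));
                  mkvf (fun t x u : R => (1, 0, 0));
                  mkvf (fun t x u : R => (5 * t, x, - 4 * u))])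
    ([set lin_span [:: mkvf (fun t x u : R => (0, 1, 0))]]
     `|` [set lin_span [:: mkvf (fun t x u : R => (1, 0, 0))]]
     `|` [set lin_span [:: mkvf (fun t x u : R => (sigma, t, 1))]
         | sigma in [set -1; 0; 1]]
     `|` [set lin_span [:: mkvf (fun t x u : R => (5 * t, x, - 4 * u))]]).
Proof.
split; first exact: optimal_system_case0.
split; first by move=> rho _ _; exact: optimal_system_case1.
split; first exact: optimal_system_case1_singular.
split; first exact: optimal_system_case2.
split; first by move=> nu _; exact: optimal_system_case3.
exact: optimal_system_case4.
Qed.
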